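(* Let $G$ be a simple undirected graph with $n$ vertices and at least one edge, and let $\mu_2$ and $\mu_n$ denote the second smallest and the largest eigenvalue of the Laplacian matrix of $G$, respectively. Suppose that $S \subset V(G)$ is such that $G - S$ is disconnected. Let $X$ and $Y$ be disjoint vertex subsets of $G-S$ such that $X \cup Y = V(G) - S$ with $|X| \le |Y|$. Then $$|X| \le \frac{\mu_n - \mu_2}{2\mu_n}\cdot n \qquad\text{and}\qquad |S| \ge \frac{2\mu_2}{\mu_n - \mu_2}\cdot |X|,$$ with each equality holding only when $|X| = |Y|$.
   Context: The Laplacian matrix of a graph $G$ is $L = D - A$, where $D$ is the diagonal matrix of vertex degrees and $A$ is the adjacency matrix of $G$. Its eigenvalues are listed with multiplicity in nondecreasing order $0=\mu_1 \le \mu_2 \le \cdots \le \mu_n$, so $\mu_i$ is the $i$-th smallest Laplacian eigenvalue. $V(G)$ is the vertex set of $G$, and $G - S$ is the subgraph of $G$ induced on $V(G) \setminus S$.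
   Formalization: X and Y are additionally assumed to have no edge of G between them (the claim fails for arbitrary splits, e.g. in the Petersen graph), and equality in the bound on |S| is claimed to force |X| = |Y| only when S is nonempty (it fails for K_1 + K_2 with S empty). *)

(* Defs.v *)
From mathcomp Require Import all_boot all_order all_algebra.
From mathcomp Require Import spectral complex.

Set Implicit Arguments.
Unset Strict Implicit.
Unset Printing Implicit Defensive.

Import Order.TTheory GRing.Theory Num.Theory.
Local Open Scope ring_scope.

Section Graph.
Variables (T : finType) (e : rel T).

Definition simple_graph : Prop := symmetric e /\ irreflexive e.

Definition degree (x : T) : nat := #|[set y | e x y]|.

(* Edge relation of G - S; the vertex set of G - S is ~: S. *)
Definition del_edge (S : {set T}) : rel T :=
  [rel x y | [&& x \notin S, y \notin S & e x y]].

Definition del_disconnected (S : {set T}) : Prop :=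
  exists x y, [/\ x \notin S, y \notin S & ~~ connect (del_edge S) x y].

Definition no_edge_between (X Y : {set T}) : Prop :=
  {in X & Y, forall x y, ~~ e x y}.

End Graph.

Section Laplacian.
Variables (R : rcfType) (T : finType) (e : rel T).

(* Rows and columns are indexed by 'I_#|T|, the i-th vertex being enum_val i. *)
Definition adjacency : 'M[R]_#|T| :=
  \matrix_(i, j) (e (enum_val i) (enum_val j))%:R.

Definition laplacian : 'M[R]_#|T| :=
  diag_mx (\row_i (degree e (enum_val i))%:R) - adjacency.

Definition is_laplacian_spectrum (mu : #|T|.-tuple R) : Prop :=
  sorted <=%R mu /\ char_poly laplacian = \prod_(a <- mu) ('X - a%:P).

Lemma laplacian_spectrum_exists :
  symmetric e -> exists mu : #|T|.-tuple R, is_laplacian_spectrum mu.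
Proof.
move=> esym; pose f := real_complex R.
have fR x : f x \is Num.real by apply/complex_realP; exists x.
pose A := map_mx f laplacian.
have Aherm : A \is hermsymmx.
  apply: realsym_hermsym; last first.
    by apply/mxOverP => i j; rewrite mxE fR.
  apply/is_hermitianmxP; rewrite expr0 scale1r map_mx_id //.
  apply/matrixP => i j; rewrite !mxE esym eq_sym.
  by case: eqP => [->|].
have Adiag := orthomx_spectralP (hermitian_normalmx Aherm).
have dR := hermitian_spectral_diag_real Aherm.
have Punit := spectral_unit A.
move: (spectralmx A) (spectral_diag A) Adiag dR Punit => P d Adiag dR Punit.
have charA : char_poly A = \prod_i ('X - (d 0 i)%:P).
  have -> : char_poly A = char_poly (diag_mx d).
    rewrite Adiag /char_poly /char_poly_mx !map_mxM.
    have VP : map_mx polyC (invmx P) *m map_mx polyC P = 1%:M.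
      by rewrite -map_mxM mulVmx // map_mx1.
    set Q := map_mx _ (invmx P) in VP *; set P' := map_mx _ P in VP *.
    have XE : 'X%:M = Q *m 'X%:M *m P' :> 'M_#|T|.
      by rewrite scalar_mxC -mulmxA VP mulmx1.
    rewrite {1}XE -mulmxBl -mulmxBr !det_mulmx mulrAC -det_mulmx VP det1.
    by rewrite mul1r.
  rewrite char_poly_trig ?diag_mx_is_trig //.
  by apply: eq_bigr => i _; rewrite mxE eqxx.
pose s := [seq complex.Re (d 0 i) | i <- enum 'I_#|T|].
have size_s : size (sort <=%R s) == #|T| by rewrite size_sort size_map size_enum_ord.
exists (Tuple size_s); split; first exact: sort_le_sorted.
apply: (map_poly_inj f); rewrite map_char_poly -/A charA rmorph_prod /=.
rewrite (perm_big s) ?perm_sort //= big_map big_enum /=.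
apply: eq_bigr => i _; rewrite rmorphB /= map_polyX map_polyC /=.
by congr (_ - _%:P); rewrite RRe_real //; apply: (mxOverP dR).
Qed.

End Laplacian.

(* Main.v *)
Require Import Defs.
From mathcomp Require Import all_boot all_order all_algebra.
From mathcomp Require Import fingroup perm spectral complex ring lra.
Import Order.TTheory GRing.Theory Num.Theory.
Local Open Scope ring_scope.
Local Open Scope sesquilinear_scope.

Set Implicit Arguments.
Unset Strict Implicit.
Unset Printing Implicit Defensive.

(** Let L be the Laplacian, a = (mu_2 + mu_n) / 2 and b = (mu_n - mu_2) / 2.
    On the hyperplane orthogonal to the all-ones vector 1 the eigenvalues of L
    lie in [mu_2, mu_n], so L - a has norm at most b there
    ([laplacian_centered_norm]).  If no edge joins the disjoint sets X and Y,
    their indicators u and w satisfy u L w = 0 and u w = 0.  Projecting them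
    orthogonally to 1 gives vectors u', w' with

        u' (L - a) w' = a |X| |Y| / n,
        |u'|^2 = |X| (n - |X|) / n,   |w'|^2 = |Y| (n - |Y|) / n,

    and Cauchy-Schwarz turns the norm bound into Haemers' inequality
    ([separation_inequality])

        (mu_2 + mu_n)^2 |X| |Y| <= (mu_n - mu_2)^2 (n - |X|) (n - |Y|).

    Here n - |X| = |Y| + |S| and n - |Y| = |X| + |S|.  As |X| <= |Y|, the
    quotient (|Y| + |S|) / |Y| is at most (|X| + |S|) / |X|, so the inequality
    weakens to the linear one

        (mu_2 + mu_n) |X| <= (mu_n - mu_2) (|X| + |S|),

    which rearranges to both bounds.  Equality in the first bound forces
    2 |X| + |S| = n, and equality in the second forces equality of the two
    quotients; either way |X| = |Y|, provided that S is nonempty in the second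
    case ([separation_arithmetic]).

    Dividing by mu_n - mu_2 is legitimate: applied to two single
    vertices in different components of G - S, Haemers' inequality reads
    (mu_2 + mu_n)^2 <= (mu_n - mu_2)^2 (n - 1)^2, and the left side is positive.

    The norm bound rests on the spectral theorem, used through coordinates in a
    complex orthonormal eigenbasis ([symmetric_eigencoordinates]).  The vector 1
    need not belong to that basis; when it does not, 0 is a multiple eigenvalue,
    hence mu_2 = 0, and all eigenvalues lie in [mu_2, mu_n] anyway
    ([quadratic_form_between_eigenvalues]). *)

(** * The standard inner product *)

Definition dot (R : comPzRingType) n (u v : 'rV[R]_n) : R :=
  \sum_i u 0 i * v 0 i.

Section Dot.
Variables (R : comPzRingType) (n : nat).
Implicit Types (u v w : 'rV[R]_n) (a : R).

Lemma dotE u v : dot u v = (u *m v^T) 0 0.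
Proof. by rewrite mxE; apply: eq_bigr => i _; rewrite mxE. Qed.

Lemma dotC u v : dot u v = dot v u.
Proof. by apply: eq_bigr => i _; rewrite mulrC. Qed.

Lemma dotDl u v w : dot (u + v) w = dot u w + dot v w.
Proof. by rewrite -big_split; apply: eq_bigr => i _; rewrite mxE mulrDl. Qed.

Lemma dotZl a u w : dot (a *: u) w = a * dot u w.
Proof. by rewrite mulr_sumr; apply: eq_bigr => i _; rewrite mxE mulrA. Qed.

Lemma dotBl u v w : dot (u - v) w = dot u w - dot v w.
Proof. by rewrite -scaleN1r dotDl dotZl mulN1r. Qed.

Lemma dotBr u v w : dot w (u - v) = dot w u - dot w v.
Proof. by rewrite dotC dotBl !(dotC w). Qed.

Lemma dotZr a u w : dot w (a *: u) = a * dot w u.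
Proof. by rewrite dotC dotZl dotC. Qed.

Lemma dot_adjoint (A : 'M[R]_n) u v : dot (u *m A) v = dot u (v *m A^T).
Proof. by rewrite !dotE trmx_mul trmxK mulmxA. Qed.

End Dot.

(** Lagrange's identity: twice the difference of the two sides is the sum over
    i, j of (u_i v_j - u_j v_i)^2. *)
Lemma dot_CauchySchwarz (R : realDomainType) n (u v : 'rV[R]_n) :
  dot u v ^+ 2 <= dot u u * dot v v.
Proof.
have: 0 <= \sum_i \sum_j (u 0 i * v 0 j - u 0 j * v 0 i) ^+ 2.
  by do 2![apply: sumr_ge0 => ? _]; apply: sqr_ge0.
have -> : \sum_i \sum_j (u 0 i * v 0 j - u 0 j * v 0 i) ^+ 2
   = 2 * (dot u u * dot v v - dot u v ^+ 2).
  have P (f g : 'I_n -> R) :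
      (\sum_i f i) * (\sum_j g j) = \sum_i \sum_j f i * g j.
    by rewrite mulr_suml; apply: eq_bigr => i _; rewrite mulr_sumr.
  have S : dot u u * dot v v = \sum_i \sum_j (u 0 j * u 0 j) * (v 0 i * v 0 i).
    rewrite mulrC P; apply: eq_bigr => i _.
    by apply: eq_bigr => j _; rewrite mulrC.
  have -> : 2 * (dot u u * dot v v - dot u v ^+ 2)
     = dot u u * dot v v + dot u u * dot v v - (dot u v ^+ 2 + dot u v ^+ 2).
    ring.
  rewrite {2}S expr2 !P -!big_split -sumrB; apply: eq_bigr => i _ /=.
  by rewrite -!big_split -sumrB; apply: eq_bigr => j _ /=; ring.
by rewrite pmulr_rge0 // subr_ge0.
Qed.

Lemma dot_ge0 (R : realDomainType) n (u : 'rV[R]_n) : 0 <= dot u u.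
Proof. by rewrite sumr_ge0 // => i _; rewrite -expr2 sqr_ge0. Qed.

Lemma dot_eq0 (R : realDomainType) n (u : 'rV[R]_n) :
  (dot u u == 0) = (u == 0).
Proof.
apply/idP/eqP => [|->]; last by rewrite /dot big1 // => i _; rewrite mxE mul0r.
rewrite psumr_eq0 => [/allP u0|i _]; last by rewrite -expr2 sqr_ge0.
apply/rowP => i; rewrite mxE; apply/eqP.
by have := u0 i (mem_index_enum _); rewrite mulf_eq0 orbb.
Qed.

(** * Eigenvalue bounds for real symmetric matrices *)

Lemma char_poly_similar (R : comUnitRingType) n (P B : 'M[R]_n) :
  P \in unitmx -> char_poly (invmx P *m B *m P) = char_poly B.
Proof.
move=> Pu; rewrite /char_poly /char_poly_mx !map_mxM.
have VP : map_mx polyC (invmx P) *m map_mx polyC P = 1%:M.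
  by rewrite -map_mxM mulVmx // map_mx1.
set Q := map_mx _ (invmx P) in VP *; set P' := map_mx _ P in VP *.
have XE : 'X%:M = Q *m 'X%:M *m P' :> 'M_n.
  by rewrite scalar_mxC -mulmxA VP mulmx1.
by rewrite {1}XE -mulmxBl -mulmxBr !det_mulmx mulrAC -det_mulmx VP det1 mul1r.
Qed.

Lemma sorted_tuple_le (R : numDomainType) n (t : n.-tuple R) i j :
  sorted <=%R t -> (i <= j < n)%N -> t`_i <= t`_j.
Proof.
move=> t_sorted /andP[ij jn].
by apply: (sorted_leq_nth le_trans le_refl) => //; rewrite inE size_tuple //;
  apply: leq_ltn_trans jn.
Qed.

Section Spectral.
Variables (R : rcfType) (n : nat) (A : 'M[R]_n) (mu : n.-tuple R).
Hypotheses (Asym : A^T = A) (charA : char_poly A = \prod_(a <- mu) ('X - a%:P)).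

Local Notation f := (real_complex R).

(** The coordinate functions c_i of a complex orthonormal eigenbasis of A,
    indexed so that the i-th basis vector has eigenvalue mu_i.  They take
    complex values, even on real vectors, since the eigenbasis comes from the
    spectral theorem over the complex extension of R. *)
Lemma symmetric_eigencoordinates :
  exists c : 'I_n -> 'rV[R]_n -> R[i],
  [/\ forall i, {morph c i : u v / u - v},
      forall i a v, c i (a *: v) = f a * c i v,
      forall i v, c i (v *m A) = f mu`_i * c i v
    & forall u v, f (dot u v) = \sum_i c i u * (c i v)^*].
Proof.
have fR x : f x \is Num.real by apply/complex_realP; exists x.
pose B := map_mx f A.
have Bherm : B \is hermsymmx.
  apply: realsym_hermsym; last by apply/mxOverP => i j; rewrite mxE fR.
  apply/is_hermitianmxP; rewrite expr0 scale1r map_mx_id //.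
  by rewrite map_trmx Asym.
have Bdiag := orthomx_spectralP (hermitian_normalmx Bherm).
have Pu := spectral_unitarymx B.
move: (spectralmx B) (spectral_diag B) Bdiag Pu => P d Bdiag Pu.
have Punit := unitarymx_unit Pu.
(* The spectral diagonal and mu list the same roots, possibly in another
   order; the permutation s matches the two. *)
have /tuple_permP[s ds] : perm_eq [seq d 0 i | i <- enum 'I_n] (map_tuple f mu).
  apply: prod_XsubC_eq; rewrite big_map big_enum /= big_map.
  have <- : char_poly B = \prod_i ('X - (d 0 i)%:P).
    rewrite {1}Bdiag char_poly_similar // char_poly_trig ?diag_mx_is_trig //.
    by apply: eq_bigr => i _; rewrite mxE eqxx.
  rewrite -map_char_poly charA rmorph_prod.
  by apply: eq_bigr => a _; rewrite rmorphB /= map_polyX map_polyC.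
have dE i : d 0 i = f mu`_(s i).
  have := congr1 (fun t => nth 0 t i) ds.
  rewrite (nth_map i) ?size_enum_ord ?ltn_ord // nth_ord_enum => ->.
  by rewrite -[nth _ _ _]tnth_nth tnth_mktuple tnth_map (tnth_nth 0).
pose Q := invmx P.
have BQ : B *m Q = Q *m diag_mx d by rewrite {1}Bdiag -!mulmxA mulmxV ?mulmx1.
have QV : Q *m Q ^t* = 1%:M.
  by rewrite /Q invmx_unitary // trmxCK -invmx_unitary // mulVmx.
exists (fun i v => (map_mx f v *m Q) 0 (s^-1%g i)); split.
- by move=> i u v /=; rewrite map_mxB mulmxBl !mxE.
- by move=> i a v; rewrite map_mxZ -scalemxAl mxE.
- move=> i v; rewrite map_mxM -mulmxA BQ mulmxA mul_mx_diag mxE dE permKV.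
  by rewrite mulrC.
- move=> u v; set U := map_mx f u; set V := map_mx f v.
  have VC : V ^t* = map_mx f v^T.
    by apply/matrixP => i j; rewrite !mxE; apply: conj_Creal.
  transitivity ((U *m Q *m (V *m Q) ^t*) 0 0).
    rewrite trmx_mul map_mxM mulmxA -(mulmxA U Q) QV mulmx1 VC.
    by rewrite -map_mxM mxE dotE.
  rewrite mxE (reindex_inj (@perm_inj _ s^-1%g)) /=.
  apply: eq_bigr => i _; congr (_ * _).
  by rewrite mxE; congr (_^*); rewrite mxE.
Qed.

(** In eigencoordinates the left side is the sum over i of
    (mu_i - mu_1) (mu_i - mu_(n-1)) |c_i(v)|^2 (0-based indices, so mu_1 is the
    second smallest eigenvalue).  Only the term with i = 0 can be positive,
    and only if mu_0 is a simple eigenvalue; then z spans its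
    eigenspace, and c_0(v) = 0 because v is orthogonal to z. *)
Lemma quadratic_form_between_eigenvalues (z v : 'rV[R]_n) :
    sorted <=%R mu -> z != 0 -> z *m A = mu`_0 *: z -> dot z v = 0 ->
  dot (v *m A - mu`_1 *: v) (v *m A - mu`_n.-1 *: v) <= 0.
Proof.
move=> mu_sorted zn0 zA zv0.
have [c [cB cZ cA cdot]] := symmetric_eigencoordinates.
have mu_le i j : (i <= j < n)%N -> mu`_i <= mu`_j by exact: sorted_tuple_le.
rewrite -(lecR _ 0) cdot; apply: sumr_le0 => i _.
have -> : c i (v *m A - mu`_1 *: v) * (c i (v *m A - mu`_n.-1 *: v))^*
    = f ((mu`_i - mu`_1) * (mu`_i - mu`_n.-1)) * `|c i v| ^+ 2.
  rewrite !cB !cA !cZ -!mulrBl -!rmorphB normCK [f (_ * _)]rmorphM.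
  have fC (a : R) (x : R[i]) : (f a * x)^* = f a * x^*.
    by rewrite rmorphM; congr (_ * _); exact: conjc_real.
  by rewrite fC mulrACA.
have n_gt0 : (0 < n)%N := leq_ltn_trans (leq0n i) (ltn_ord i).
have [i0|ipos] := posnP i; last first.
  rewrite mulr_le0_ge0 ?exprn_ge0 // lecR mulr_ge0_le0 // ?subr_ge0 ?subr_le0.
    by apply: mu_le; rewrite ipos ltn_ord.
  by apply: mu_le; rewrite -ltnS prednK // ltn_ord leqnn.
have [->|mu01] := eqVneq mu`_i mu`_1; first by rewrite subrr mul0r mul0r.
suff -> : c i v = 0 by rewrite normr0 expr0n mulr0.
(* mu_0 is simple here, so z has no other coordinate than the i-th one. *)
have cz0 j : j != i -> c j z = 0.
  move=> ji; have jpos : (0 < j)%N.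
    by rewrite lt0n -i0; apply: contra ji => /eqP ji; apply/eqP/val_inj.
  have : f (mu`_j - mu`_0) * c j z = 0.
    by rewrite rmorphB mulrBl -cA -cZ zA subrr.
  move/eqP; rewrite mulf_eq0 => /orP[|/eqP //].
  rewrite fmorph_eq0 subr_eq0 => /eqP j0; case/negP: mu01.
  rewrite i0 eq_le -{2}j0 !mu_le // ?jpos ?ltn_ord //.
  by rewrite (leq_ltn_trans _ (ltn_ord j)).
have dotzE u : f (dot z u) = c i z * (c i u)^*.
  by rewrite cdot (bigD1 i) //= big1 ?addr0 // => j ji; rewrite cz0 ?mul0r.
have : c i z != 0.
  apply: contra zn0 => /eqP ciz; have /eqP := dotzE z.
  by rewrite ciz mul0r fmorph_eq0 dot_eq0.
move=> ciz; have /eqP := dotzE v.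
by rewrite zv0 rmorph0 eq_sym mulf_eq0 (negPf ciz) conjC_eq0 => /eqP.
Qed.

End Spectral.

(** * The Laplacian of a simple graph *)

Section Laplacian.
Variables (R : rcfType) (T : finType) (e : rel T).
Hypotheses (esym : symmetric e) (eirr : irreflexive e).

Local Notation n := #|T|.
Local Notation L := (laplacian R e).
Local Notation one := (const_mx 1 : 'rV[R]_n).

Lemma sum_enum_val (F : T -> R) : \sum_(i < n) F (enum_val i) = \sum_x F x.
Proof.
rewrite [RHS](reindex_onto (@enum_val T predT) enum_rank) /=.
  by apply: eq_bigl => i; rewrite enum_valK eqxx.
by move=> x _; rewrite enum_rankK.
Qed.

Lemma sum_indicator (A : {set T}) : \sum_x (x \in A)%:R = #|A|%:R :> R.
Proof.
rewrite -sum1_card natr_sum [RHS]big_mkcond /=.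
by apply: eq_bigr => x _; case: (x \in A).
Qed.

Lemma adjacency_row_sum i :
  \sum_j adjacency R e i j = (degree e (enum_val i))%:R.
Proof.
rewrite -sum_indicator -sum_enum_val.
by apply: eq_bigr => j _; rewrite mxE inE.
Qed.

Lemma laplacian_sym : L^T = L.
Proof.
apply/matrixP => i j; rewrite !mxE esym eq_sym.
by case: eqP => [->|].
Qed.

Lemma mulmx_laplacian (v : 'rV[R]_n) j :
  (v *m L) 0 j = \sum_i adjacency R e j i * (v 0 j - v 0 i).
Proof.
rewrite mulmxBr mul_mx_diag !mxE.
under [RHS]eq_bigr do rewrite mulrBr.
rewrite sumrB -mulr_suml adjacency_row_sum mulrC; congr (_ - _).
by apply: eq_bigr => i _; rewrite mulrC !mxE esym.
Qed.

Lemma const_mulmx_laplacian : one *m L = 0.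
Proof.
apply/rowP => j; rewrite mulmx_laplacian [RHS]mxE big1 // => i _.
by rewrite !mxE subrr mulr0.
Qed.

(** The quadratic form of L is the sum over edges {i, j} of (v_i - v_j)^2; the
    proof averages two expressions of it that are exchanged by swapping i and
    j. *)
Lemma laplacian_psd (v : 'rV[R]_n) : 0 <= dot (v *m L) v.
Proof.
pose a := adjacency R e.
have asym i j : a i j = a j i by rewrite !mxE esym.
have E1 : dot (v *m L) v = \sum_i \sum_j a i j * ((v 0 i - v 0 j) * v 0 i).
  apply: eq_bigr => i _; rewrite mulmx_laplacian mulr_suml.
  by apply: eq_bigr => j _; rewrite mulrA.
have E2 : dot (v *m L) v = \sum_i \sum_j a i j * ((v 0 j - v 0 i) * v 0 j).
  rewrite E1 exchange_big /=; apply: eq_bigr => i _; apply: eq_bigr => j _.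
  by rewrite asym.
have : 0 <= dot (v *m L) v + dot (v *m L) v.
  rewrite {1}E1 E2 -big_split sumr_ge0 // => i _ /=.
  rewrite -big_split sumr_ge0 // => j _ /=.
  rewrite -mulrDr mulr_ge0 ?mxE ?ler0n //.
  rewrite (_ : _ + _ = (v 0 i - v 0 j) ^+ 2) ?sqr_ge0 //; ring.
lra.
Qed.

Definition indicator (X : {set T}) : 'rV[R]_n := \row_i (enum_val i \in X)%:R.

Lemma dot_indicator (X Y : {set T}) :
  dot (indicator X) (indicator Y) = #|X :&: Y|%:R.
Proof.
rewrite -sum_indicator -sum_enum_val.
by apply: eq_bigr => i _; rewrite !mxE inE -natrM mulnb.
Qed.

Lemma one_indicator : one = indicator [set: T].
Proof. by apply/rowP => i; rewrite !mxE inE. Qed.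

Lemma dot_one_indicator (X : {set T}) : dot one (indicator X) = #|X|%:R.
Proof. by rewrite one_indicator dot_indicator setTI. Qed.

Lemma dot_one_one : dot one one = n%:R.
Proof. by rewrite {2}one_indicator dot_one_indicator cardsT. Qed.

(** Only the diagonal of L (killed by disjointness) and the entries of edges
    between X and Y could contribute. *)
Lemma dot_indicator_laplacian (X Y : {set T}) :
  [disjoint X & Y] -> no_edge_between e X Y ->
  dot (indicator Y *m L) (indicator X) = 0.
Proof.
move=> /pred0P disXY noXY; apply: big1 => i _; rewrite mulmx_laplacian !mxE.
have [iX|] := boolP (_ \in X); last by rewrite mulr0.
rewrite mulr1; apply: big1 => j _; rewrite !mxE.
have /= := disXY (enum_val i); rewrite iX => /= ->.
have [jY|_] := boolP (enum_val j \in Y); last by rewrite subrr mulr0.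
by rewrite (negPf (noXY _ _ iX jY)) mul0r.
Qed.

Section Spectrum.
Variable mu : n.-tuple R.
Hypothesis spec : is_laplacian_spectrum e mu.

Lemma laplacian_eigenvalue a : (a \in mu) = eigenvalue L a.
Proof. by rewrite eigenvalue_root_char (proj2 spec) root_prod_XsubC. Qed.

Lemma spectrum_le i j : (i <= j < n)%N -> mu`_i <= mu`_j.
Proof. exact: sorted_tuple_le (proj1 spec). Qed.

Lemma spectrum_ge0 i : 0 <= mu`_i.
Proof.
have [ni|ilt] := leqP n i; first by rewrite nth_default ?size_tuple.
have /eigenvalueP[v vL vn0] : eigenvalue L mu`_i.
  by rewrite -laplacian_eigenvalue mem_nth ?size_tuple.
have v_gt0 : 0 < dot v v.
  by rewrite lt0r dot_eq0 vn0 dot_ge0.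
by have := laplacian_psd v; rewrite vL dotZl pmulr_lge0.
Qed.

Lemma spectrum_fst : mu`_0 = 0.
Proof.
have [n0|n_gt0] := posnP n; first by rewrite nth_default ?size_tuple ?n0.
have : 0 \in mu.
  rewrite laplacian_eigenvalue; apply/eigenvalueP; exists one.
    by rewrite const_mulmx_laplacian scale0r.
  apply/eqP => /rowP/(_ (Ordinal n_gt0)); rewrite !mxE => /eqP.
  by rewrite oner_eq0.
move=> mu0; apply/le_anti; rewrite spectrum_ge0 andbT.
rewrite -{2}(nth_index 0 mu0) spectrum_le //.
by have := mu0; rewrite -index_mem size_tuple.
Qed.

(** The all-ones vector is an eigenvector for the smallest eigenvalue 0, so it
    serves as the vector z of [quadratic_form_between_eigenvalues]. *)
Lemma laplacian_quadratic_form (v : 'rV[R]_n) : dot one v = 0 ->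
  dot (v *m L - mu`_1 *: v) (v *m L - mu`_n.-1 *: v) <= 0.
Proof.
have [n0 _|n_gt0] := posnP n.
  by apply: sumr_le0 => -[i ilt]; exfalso; rewrite n0 in ilt.
apply: quadratic_form_between_eigenvalues (proj1 spec) _ _ => //.
- exact: laplacian_sym.
- exact: proj2 spec.
- apply/eqP => /rowP/(_ (Ordinal n_gt0)); rewrite !mxE => /eqP.
  by rewrite oner_eq0.
- by rewrite const_mulmx_laplacian spectrum_fst scale0r.
Qed.

(** If mu_(n-1) = 0 then all eigenvalues vanish, so [laplacian_quadratic_form]
    says that L kills every vector orthogonal to 1, hence every vector; but an
    edge xy makes an entry of L equal to -1. *)
Lemma laplacian_max_gt0 : (exists x y : T, e x y) -> 0 < mu`_n.-1.
Proof.
move=> [x [y exy]]; rewrite lt0r spectrum_ge0 andbT; apply/eqP => mun0.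
have n_gt0 : (0 < n)%N by apply/card_gt0P; exists x.
have nR : n%:R != 0 :> R by rewrite pnatr_eq0 -lt0n.
have mu1 : mu`_1 = 0.
  apply/le_anti; rewrite spectrum_ge0 andbT.
  have [|n1] := ltnP 1 n; last by rewrite nth_default ?size_tuple.
  move=> n1; rewrite -[X in _ <= X]mun0 spectrum_le //.
  by rewrite -ltnS prednK // n1 leqnn.
pose u := indicator [set x]; pose v := u - (n%:R^-1) *: one.
have v1 : dot one v = 0.
  rewrite dotBr dotZr dot_one_indicator cards1.
  by rewrite dot_one_one mulVf // subrr.
have := laplacian_quadratic_form v1.
rewrite mun0 mu1 scale0r subr0 => vL0.
have : (v *m L) 0 (enum_rank y) = 0.
  suff -> : v *m L = 0 by rewrite mxE.
  by apply/eqP; rewrite -dot_eq0 eq_le vL0 dot_ge0.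
rewrite mulmxBl -scalemxAl const_mulmx_laplacian scaler0 subr0.
have yx : y != x by apply: contraTneq exy => ->; rewrite eirr.
rewrite mulmx_laplacian (bigD1 (enum_rank x)) //= big1 => [|i ix].
  rewrite !mxE !enum_rankK !inE eqxx (negPf yx) esym exy => /eqP.
  by rewrite addr0 mul1r sub0r oppr_eq0 oner_eq0.
rewrite !mxE enum_rankK !inE (negPf yx) (_ : _ == x = false) ?subrr ?mulr0 //.
by apply: contraNF ix => /eqP <-; rewrite enum_valK.
Qed.

Local Notation mid := ((mu`_1 + mu`_n.-1) / 2).
Local Notation half_gap := ((mu`_n.-1 - mu`_1) / 2).

(** The square of the norm of (L - mid) v is the quadratic form of
    (L - mu_1) (L - mu_(n-1)) at v plus half_gap^2 |v|^2. *)
Lemma laplacian_centered_norm (v : 'rV[R]_n) : dot one v = 0 ->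
  dot (v *m L - mid *: v) (v *m L - mid *: v) <= half_gap ^+ 2 * dot v v.
Proof.
move=> v1; have := laplacian_quadratic_form v1; rewrite -subr_ge0 => vL.
rewrite -subr_ge0; apply: le_trans vL _.
rewrite le_eqVlt; apply/orP; left; apply/eqP.
by rewrite !(dotBl, dotBr, dotZl, dotZr) (dotC v (v *m L)); field.
Qed.

(** Haemers' inequality: Cauchy-Schwarz for u0 and (L - mid) w0, where u0 and w0
    are the indicators of X and Y projected orthogonally to the all-ones
    vector.  The projection is what yields the factors n - |X| and n - |Y|. *)
Lemma separation_inequality (X Y : {set T}) :
    [disjoint X & Y] -> no_edge_between e X Y ->
  (mu`_1 + mu`_n.-1) ^+ 2 * (#|X|%:R * #|Y|%:R)
    <= (mu`_n.-1 - mu`_1) ^+ 2 * ((n%:R - #|X|%:R) * (n%:R - #|Y|%:R)).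
Proof.
move=> disXY noXY; set x := #|X|%:R; set y := #|Y|%:R.
have xn : x <= n%:R by rewrite ler_nat max_card.
have yn : y <= n%:R by rewrite ler_nat max_card.
have x_ge0 : 0 <= x by exact: ler0n.
have y_ge0 : 0 <= y by exact: ler0n.
have [xy0|] := eqVneq (x * y) 0.
  by rewrite xy0 mulr0 mulr_ge0 ?sqr_ge0 // mulr_ge0 // subr_ge0.
move=> xyn0; have xy_gt0 : 0 < x * y by rewrite lt0r xyn0 mulr_ge0.
have n_gt0 : 0 < n%:R :> R.
  apply: lt_le_trans xn; rewrite lt0r x_ge0 andbT.
  by apply: contraNneq xyn0 => ->; rewrite mul0r.
have nn0 : n%:R != 0 :> R by rewrite gt_eqF.
pose u := indicator X; pose w := indicator Y.
pose u0 := u - (x / n%:R) *: one; pose w0 := w - (y / n%:R) *: one.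
pose a := mid; pose b := half_gap.
have one1 := dot_one_one.
have oneu : dot one u = x by exact: dot_one_indicator.
have onew : dot one w = y by exact: dot_one_indicator.
have uone : dot u one = x by rewrite dotC.
have wone : dot w one = y by rewrite dotC.
have uu : dot u u = x by rewrite dot_indicator setIid.
have ww : dot w w = y by rewrite dot_indicator setIid.
have uw : dot u w = 0.
  by rewrite dot_indicator disjoint_setI0 // cards0.
have u0u0 : dot u0 u0 = x * (n%:R - x) / n%:R.
  by rewrite !(dotBl, dotBr, dotZl, dotZr) uu oneu uone one1; field.
have w0w0 : dot w0 w0 = y * (n%:R - y) / n%:R.
  by rewrite !(dotBl, dotBr, dotZl, dotZr) ww onew wone one1; field.
have u0w0 : dot u0 w0 = - (x * y / n%:R).
  by rewrite !(dotBl, dotBr, dotZl, dotZr) uw onew uone one1; field.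
have one_w0 : dot one w0 = 0.
  by rewrite dotBr dotZr onew one1 mulfVK // subrr.
have w0L : w0 *m L = w *m L.
  by rewrite mulmxBl -scalemxAl const_mulmx_laplacian scaler0 subr0.
have u0w0L : dot u0 (w0 *m L) = 0.
  rewrite w0L dotBl dotZl [dot u _]dotC dot_indicator_laplacian //.
  rewrite -[L]laplacian_sym -dot_adjoint const_mulmx_laplacian.
  by rewrite -(scale0r one) dotZl mul0r mulr0 subrr.
pose m := w0 *m L - a *: w0.
have mm : dot m m <= b ^+ 2 * dot w0 w0 by exact: laplacian_centered_norm.
have := dot_CauchySchwarz u0 m.
have -> : dot u0 m = a * (x * y / n%:R).
  by rewrite dotBr dotZr u0w0L u0w0 mulrN opprK add0r.
move=> /le_trans/(_ (ler_wpM2l (dot_ge0 u0) mm)); rewrite u0u0 w0w0.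
(* The Cauchy-Schwarz bound is the claim with both sides multiplied by c. *)
set c := x * y / (n%:R ^+ 2 * 4).
have c_gt0 : 0 < c by rewrite divr_gt0 // mulr_gt0 // exprn_gt0.
rewrite -subr_ge0 => H; rewrite -subr_ge0 -(pmulr_rge0 _ c_gt0).
apply: le_trans H _; rewrite le_eqVlt; apply/orP; left; apply/eqP.
by rewrite /c /a /b; field.
Qed.

End Spectrum.

End Laplacian.

(** * From the product inequality to the two bounds *)

(** Everything follows from [main]; its proof multiplies the hypothesis by x
    and uses [ratio], which is x <= y up to the factor s.  In the two equality
    cases the slack in 2 x + s <= x + y + s, respectively in [ratio], has to
    vanish; [ratio] is an identity when s = 0, whence the condition in the last
    clause. *)
Lemma separation_arithmetic (R : realFieldType) (m2 mn x y s : R) :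
    0 <= m2 -> m2 < mn -> 0 <= x -> x <= y -> 0 <= s ->
    (m2 + mn) ^+ 2 * (x * y) <= (mn - m2) ^+ 2 * ((y + s) * (x + s)) ->
  [/\ x <= (mn - m2) / (2 * mn) * (x + y + s),
      2 * m2 / (mn - m2) * x <= s,
      x = (mn - m2) / (2 * mn) * (x + y + s) -> x = y
    & s != 0 -> s = 2 * m2 / (mn - m2) * x -> x = y].
Proof.
move=> m2_ge0 m2n x_ge0 xy s_ge0; set A := m2 + mn; set B := mn - m2 => mix.
have B_gt0 : 0 < B by rewrite subr_gt0.
have mn_gt0 : 0 < mn by exact: le_lt_trans m2n.
have A_ge0 : 0 <= A by rewrite addr_ge0 // ltW.
have xs_ge0 : 0 <= x + s by exact: addr_ge0.
have key : 0 < x -> (A * x) ^+ 2 * y <= B ^+ 2 * (x + s) * (x * (y + s)).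
  move=> x_gt0; have := ler_wpM2r x_ge0 mix.
  by congr (_ <= _); ring.
have ratio : x * (y + s) <= (x + s) * y.
  by rewrite mulrDr mulrDl lerD2l mulrC ler_wpM2l.
have main : A * x <= B * (x + s).
  have [x0|x_neq0] := eqVneq x 0.
    by rewrite x0 mulr0 add0r mulr_ge0 // ltW.
  have x_gt0 : 0 < x by rewrite lt0r x_neq0.
  have y_gt0 : 0 < y by exact: lt_le_trans xy.
  rewrite -(ler_pXn2r (n := 2)) ?nnegrE ?mulr_ge0 ?(ltW B_gt0) //.
  rewrite -(ler_pM2r y_gt0); apply: le_trans (key x_gt0) _.
  have -> : (B * (x + s)) ^+ 2 * y = B ^+ 2 * (x + s) * ((x + s) * y) by ring.
  by rewrite ler_wpM2l // mulr_ge0 // sqr_ge0.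
have E1 z : (z <= B / (2 * mn) * (x + y + s)) = (2 * mn * z <= B * (x + y + s)).
  by rewrite mulrAC ler_pdivlMr ?mulr_gt0 // mulrC.
have E2 z : (2 * m2 / B * x <= z) = (2 * m2 * x <= B * z).
  by rewrite mulrAC ler_pdivrMr // (mulrC z).
split.
- rewrite E1; have : B * (x + (x + s)) <= B * (x + y + s).
    by rewrite ler_pM2l //; lra.
  by move: main; rewrite /A /B; lra.
- by rewrite E2; move: main; rewrite /A /B; lra.
- move=> eqx; have : B * (x + y + s) <= B * (x + (x + s)).
    have -> : B * (x + y + s) = 2 * mn * x.
      by rewrite {2}eqx; field; rewrite gt_eqF.
    by move: main; rewrite /A /B; lra.
  by rewrite ler_pM2l // => ?; lra.
- move=> s_neq0 eqs; have s_gt0 : 0 < s by rewrite lt0r s_neq0.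
  have x_gt0 : 0 < x.
    rewrite lt0r x_ge0 andbT.
    by apply: contraNneq s_neq0 => x0; rewrite eqs x0 mulr0.
  have tight : A * x = B * (x + s).
    by rewrite [in RHS]eqs /A /B; field; rewrite gt_eqF // subr_gt0.
  have : (x + s) * y <= x * (y + s).
    have c_gt0 : 0 < B ^+ 2 * (x + s).
      by apply: mulr_gt0; [apply: exprn_gt0 | apply: addr_gt0].
    rewrite -(ler_pM2l c_gt0); apply: le_trans (key x_gt0).
    by rewrite tight le_eqVlt; apply/orP; left; apply/eqP; ring.
  rewrite mulrDr mulrDl lerD2l [x * s]mulrC ler_pM2l // => yx.
  by apply/le_anti; rewrite xy yx.
Qed.

Unset Implicit Arguments.

Theorem lemma2p2 (R : rcfType) (T : finType) (e : rel T)
    (mu : #|T|.-tuple R) (S X Y : {set T}) :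
  let n := #|T| in
  let mu2 := mu`_1 in
  let mun := mu`_(n.-1) in
  simple_graph e ->
  (exists x y : T, e x y) ->
  is_laplacian_spectrum e mu ->
  del_disconnected e S ->
  [disjoint X & Y] ->
  X :|: Y = ~: S ->
  no_edge_between e X Y ->
  (#|X| <= #|Y|)%N ->
  [/\ #|X|%:R <= (mun - mu2) / (2 * mun) * n%:R,
      #|S|%:R >= 2 * mu2 / (mun - mu2) * #|X|%:R,
      #|X|%:R = (mun - mu2) / (2 * mun) * n%:R -> #|X| = #|Y|
    & S != set0 ->
      #|S|%:R = 2 * mu2 / (mun - mu2) * #|X|%:R -> #|X| = #|Y|].
Proof.
move=> n mu2 mun [esym eirr] edge spec [p [q [pS qS Npq]]] disXY XYS noXY leXY.
have pq : p != q by apply: contraNneq Npq => ->; rewrite connect0.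
have Nepq : ~~ e p q.
  by apply: contra Npq => epq; apply: connect1; apply/and3P.
have mu2_ge0 : 0 <= mu2 by exact: spectrum_ge0.
have mun_gt0 : 0 < mun by exact: laplacian_max_gt0.
have mu2_le : mu2 <= mun.
  apply: (spectrum_le spec).
  have n_gt1 : (1 < n)%N by apply/card_gt1P; exists p, q.
  by rewrite -ltnS prednK ?(ltnW n_gt1) // n_gt1 leqnn.
(* If mu_2 = mu_n, the product inequality for the sets {p} and {q} would bound a
   positive number by 0. *)
have mu2_lt : mu2 < mun.
  rewrite lt_neqAle mu2_le andbT; apply/eqP => mu2E.
  have disj : [disjoint [set p] & [set q]] by rewrite disjoints1 inE.
  have noedge : no_edge_between e [set p] [set q].
    by move=> a b; rewrite !inE => /eqP-> /eqP->.
  have := separation_inequality esym spec disj noedge.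
  rewrite -/mu2 -/mun mu2E subrr expr0n mul0r !cards1 !mulr1.
  by apply/negP; rewrite -ltNge exprn_gt0 // addr_gt0.
have cardT : n = (#|X| + #|Y| + #|S|)%N.
  by rewrite -cardsUI disjoint_setI0 // cards0 addn0 XYS addnC cardsC.
have nE : n%:R = #|X|%:R + #|Y|%:R + #|S|%:R :> R by rewrite cardT !natrD.
have := separation_inequality esym spec disXY noXY; rewrite -/n -/mu2 -/mun.
have -> : n%:R - #|X|%:R = #|Y|%:R + #|S|%:R :> R by rewrite nE; ring.
have -> : n%:R - #|Y|%:R = #|X|%:R + #|S|%:R :> R by rewrite nE; ring.
move=> /(separation_arithmetic mu2_ge0 mu2_lt (ler0n _ _) _ (ler0n _ _)).
rewrite ler_nat -nE => /(_ leXY)[c1 c2 c3 c4]; split=> //.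
- by move=> /c3/eqP; rewrite eqr_nat => /eqP.
- rewrite -cards_eq0 -(eqr_nat R) => S0 /(c4 S0)/eqP.
  by rewrite eqr_nat => /eqP.
Qed.
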